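(* Let $0<\alpha<1/2$ and $p=n^{-\alpha}$. There is a constant $c=c(\alpha)$, depending only on $\alpha$, such that \[ \mathbb{P}\big(D(H_n,H_{n,p})<c\big)\to 1 \quad\text{as } n\to\infty . \]
   Context: $H_n$ is the hypercube graph with vertex set $\{0,1\}^n$, two vectors being adjacent iff they differ in exactly one coordinate. $H_{n,p}$ is the random subgraph of $H_n$ obtained by Bernoulli bond percolation: it has the same vertex set, and each edge of $H_n$ is kept (is ''open'') independently with probability $p$. Every graph is regarded as a metric space on its vertex set with the graph (shortest-path) distance; vertices in different connected components are at distance $+\infty$. For a map $f:X\to Y$ between metric spaces, $D(f)=D_+(f)/D_-(f)$ where $D_+(f)=\max\{1,\sup_{a\neq b\in X} d_Y(f(a),f(b))/d_X(a,b)\}$ and $D_-(f)=\inf_{a\neq b\in X}\max\{1,d_Y(f(a),f(b))\}/d_X(a,b)$ (maps need not be injective or surjective). The metric distortion is $D(X,Y)=\inf_{f:X\to Y}D(f)$. *)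

(* Defs.v *)
From HB Require Import structures.
From mathcomp Require Import all_boot all_order all_algebra.
From mathcomp Require Import all_classical all_reals all_analysis.
Set Implicit Arguments. Unset Strict Implicit. Unset Printing Implicit Defensive.
Import Order.TTheory GRing.Theory Num.Theory.

Local Open Scope ring_scope.

Fixpoint reach (T : finType) (e : rel T) (x : T) (k : nat) : {set T} :=
  match k with
  | 0 => [set x]
  | k'.+1 => reach e x k' :|: [set z | [exists y in reach e x k', e y z]]
  end.

(* shortest-path distance: Some k with k the least length of a walk from x
   to y, or None (= +infinity) if x and y lie in different components.
   (Shortest paths have length < #|T|, so searching below #|T| suffices.) *)
Definition gdist (T : finType) (e : rel T) (x y : T) : option nat :=
  let k := find (fun k => y \in reach e x k) (iota 0 #|T|) in
  if (k < #|T|)%N then Some k else None.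

(* the ratio num/den of two (possibly infinite) distances;
   den is finite and positive in all uses below (distinct points of H_n) *)
Definition dratio (R : realType) (num den : option nat) : \bar R :=
  match num, den with
  | Some k, Some d => (k%:R / d%:R)%:E
  | None, Some _ => +oo%E
  | _, None => 0%E
  end.

Section Distortion.
Variables (R : realType) (X Y : finType) (dX : X -> X -> option nat)
          (dY : Y -> Y -> option nat).

Definition Dplus (f : X -> Y) : \bar R :=
  maxe 1%E (\big[maxe/-oo%E]_(a : X) \big[maxe/-oo%E]_(b : X | b != a)
              dratio R (dY (f a) (f b)) (dX a b)).

Definition Dminus (f : X -> Y) : \bar R :=
  \big[mine/+oo%E]_(a : X) \big[mine/+oo%E]_(b : X | b != a)
     dratio R (omap (maxn 1) (dY (f a) (f b))) (dX a b).

(* D(f) = D_+(f)/D_-(f), with the conventions oo/x = oo and r/oo = 0 *)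
Definition distortion (f : X -> Y) : \bar R :=
  match Dplus f, Dminus f with
  | EFin r, EFin s => (r / s)%:E
  | EFin _, _ => 0%E
  | _, _ => +oo%E
  end.

Definition metric_distortion : \bar R :=
  \big[mine/+oo%E]_(f : {ffun X -> Y}) distortion f.

End Distortion.

Definition cube (n : nat) := {ffun 'I_n -> bool}.

Definition cube_adj (n : nat) : rel (cube n) :=
  fun x y => #|[set i | x i != y i]| == 1%N.

Definition cube_edges (n : nat) : {set {set cube n}} :=
  [set [set x; y] | x in cube n, y in cube n & cube_adj x y].

Definition perc_adj (n : nat) (w : {set {set cube n}}) : rel (cube n) :=
  fun x y => cube_adj x y && ([set x; y] \in w).

Definition perc_prob (R : realType) (n : nat) (p : R)
    (A : pred {set {set cube n}}) : R :=
  \sum_(w : {set {set cube n}} | (w \subset cube_edges n) && A w)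
     p ^+ #|w| * (1 - p) ^+ (#|cube_edges n| - #|w|).

Definition cube_perc_distortion (R : realType) (n : nat)
    (w : {set {set cube n}}) : \bar R :=
  metric_distortion R (gdist (@cube_adj n)) (gdist (perc_adj w)).

(* Main.v *)
(* Two vertices u and v = u + D at bounded Hamming distance can be joined by
   moving both of them along the same m fresh coordinates and then following one
   fixed walk.  Let the success probability of this search be r_m.  Choosing the
   first coordinate i in a block of N directions makes the searches for distinct
   i use disjoint sets of edges, so 1 - r_(m+1) <= (1 - p^2 r_m)^N.  As N p^2 is
   of order n^(1 - 2 alpha), a bounded number of levels brings the failure
   probability down to q = exp(- n^(1/2 - alpha)).

   Around each vertex x put two families of N^2 vertices each ("sources" and
   "targets", at distance 2 from x).  For N source-target pairs with distinct
   sources and distinct targets the searches again use disjoint edges, so all of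
   them fail with probability at most q^N.  There are at most
   2^n (n+1) N^(4N) such systems around neighbouring or equal centers, and
   q^N beats this number because N is of order n.  Hence, with high probability,
   any N sources and N targets around neighbouring centers contain a joined pair.
   By pigeonhole some source f(x) of x is then joined to N targets of x, and for
   adjacent x, y the route f(x) - target of x - source of y - target of y - f(y)
   has bounded length.  As f moves every vertex by at most 2, its distortion is
   bounded. *)
Require Import Defs.
From HB Require Import structures.
From mathcomp Require Import all_boot all_order all_algebra.
From mathcomp Require Import all_classical all_reals all_analysis.
From mathcomp Require Import fintype finset zify ring lra.
Import Order.TTheory GRing.Theory Num.Theory.
Import numFieldNormedType.Exports.
Set Implicit Arguments. Unset Strict Implicit. Unset Printing Implicit Defensive.
Local Open Scope ring_scope.
(** * Bernoulli percolation on a list of edges *)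

Section BernoulliExpectation.
Variables (R : realType) (T : finType) (p : R).
Hypothesis p01 : 0 <= p <= 1.
Implicit Types (s : seq T) (f g : {set T} -> R) (A B : {set T} -> bool).
Implicit Types (P Q : T -> Prop).

(* Reveals the elements of s one by one; when s has no duplicates this is the
   expectation of f at a random subset of s, see Ex_sum. *)
Fixpoint Ex s f : R :=
  if s is e :: s' then p * Ex s' (fun w => f (e |: w)) + (1 - p) * Ex s' f
  else f set0.

Definition Pr s A : R := Ex s (fun w => (A w)%:R).

Lemma eq_Ex s f g : f =1 g -> Ex s f = Ex s g.
Proof. by elim: s f g => //= e s IH f g fg; rewrite (IH _ _ fg) (IH _ (fun w => g (e |: w))). Qed.

Lemma le_Ex s f g : (forall w, f w <= g w) -> Ex s f <= Ex s g.
Proof.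
case/andP: p01 => p0 p1.
elim: s f g => //= e s IH f g fg.
by apply: lerD; apply: ler_wpM2l; rewrite ?subr_ge0 //; apply: IH.
Qed.

Lemma Ex_const s (c : R) : Ex s (fun=> c) = c.
Proof. by elim: s => //= e s ->; ring. Qed.

Lemma ExB s f g : Ex s (fun w => f w - g w) = Ex s f - Ex s g.
Proof. by elim: s f g => //= e s IH f g; rewrite !IH; ring. Qed.

Lemma Ex_big (I : Type) (r : seq I) s (F : I -> {set T} -> R) :
  Ex s (fun w => \sum_(i <- r) F i w) = \sum_(i <- r) Ex s (F i).
Proof.
elim: s F => //= e s IH F.
by rewrite (IH (fun i w => F i (e |: w))) IH !mulr_sumr -big_split.
Qed.

Lemma sum_subsetU1 (e : T) (S : {set T}) f : e \notin S ->
  \sum_(w : {set T} | w \subset e |: S) f w =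
  \sum_(w : {set T} | w \subset S) f (e |: w) +
  \sum_(w : {set T} | w \subset S) f w.
Proof.
move=> eS; rewrite (bigID (fun w : {set T} => e \in w)) /=; congr (_ + _).
  rewrite (reindex_onto (fun w => e |: w) (fun w => w :\ e)) /=; last first.
    by move=> w /andP[_ ew]; rewrite setD1K.
  apply: eq_bigl => w; rewrite setU11 andbT.
  apply/idP/idP => [/andP[wS /eqP wE]|wS].
    have ew : e \notin w by rewrite -wE setD11.
    apply/subsetP => x xw; have := subsetP wS x.
    rewrite !inE xw orbT => /(_ isT)/orP[/eqP xe|//].
    by rewrite xe (negbTE ew) in xw.
  have ew : e \notin w by apply: contra eS => /(subsetP wS).
  by rewrite setUS //= setU1K.
apply: eq_bigl => w; apply/idP/idP => [/andP[wS ew]|wS].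
  apply/subsetP => x xw; have := subsetP wS x xw.
  by rewrite !inE => /orP[/eqP xe|//]; rewrite -xe xw in ew.
rewrite (subset_trans wS (subsetU1 _ _)) /=.
by apply: contra eS => /(subsetP wS).
Qed.

Lemma Ex_sum s f : uniq s ->
  Ex s f = \sum_(w : {set T} | w \subset [set x in s])
     p ^+ #|w| * (1 - p) ^+ (size s - #|w|) * f w.
Proof.
elim: s f => [|e s IH] f /=.
  have -> : [set x in [::]] = set0 :> {set T} by apply/setP => x; rewrite !inE.
  move=> _; rewrite (big_pred1 set0) ?cards0 ?expr0 ?mul1r //.
  by move=> w; rewrite subset0.
case/andP=> es us; rewrite !IH //.
have -> : [set x in e :: s] = e |: [set x in s] by apply/setP => x; rewrite !inE.
rewrite sum_subsetU1 ?inE // !mulr_sumr; congr (_ + _); apply: eq_bigr => w ws.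
  rewrite cardsU1 (_ : e \notin w) ?add1n ?exprS ?subSS ?mulrA //.
  by apply: contra es => /(subsetP ws); rewrite inE.
rewrite !mulrA subSn; last first.
  by rewrite -(card_uniqP us) -[X in (_ <= X)%N]cardsE subset_leq_card.
by rewrite exprS; ring.
Qed.

Lemma Pr_ge0 s A : 0 <= Pr s A.
Proof. by rewrite -(Ex_const s 0); apply: le_Ex => w; rewrite ler0n. Qed.

Lemma le_Pr s A B : (forall w, A w -> B w) -> Pr s A <= Pr s B.
Proof. by move=> AB; apply: le_Ex => w; rewrite ler_nat; case: (A w) (AB w) => // ->. Qed.

Lemma PrN s A : Pr s (fun w => ~~ A w) = 1 - Pr s A.
Proof.
rewrite -[in X in _ = X](Ex_const s 1) -ExB; apply: eq_Ex => w.
by case: (A w); rewrite ?subrr ?subr0.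
Qed.

Lemma Pr_union (I : finType) s A (B : I -> {set T} -> bool) :
  (forall w, A w -> exists i, B i w) -> Pr s A <= \sum_i Pr s (B i).
Proof.
move=> AB; rewrite -Ex_big; apply: le_Ex => w.
case Aw : (A w); last by apply: sumr_ge0.
have [i Biw] := AB w Aw.
by rewrite (bigD1 i) //= Biw lerDl sumr_ge0.
Qed.

(** Testing one inserted element at a time is enough, since [Ex] builds its sets by insertions. A
    propositional [P] lets edges be described through their ends. *)
Definition depends_on (X : Type) (F : {set T} -> X) P :=
  forall e w, ~ P e -> F (e |: w) = F w.

(** By induction on [s]: at most one of the two factors sees the revealed element, so the average
    over it can be taken in that factor alone. *)
Lemma Ex_indep s f g P Q : depends_on f P -> depends_on g Q ->
  (forall e, P e -> Q e -> False) ->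
  Ex s (fun w => f w * g w) = Ex s f * Ex s g.
Proof.
move=> fP gQ PQ; elim: s f g fP gQ => //= e s IH f g fP gQ.
have dep (h : {set T} -> R) S : depends_on h S -> depends_on (fun w => h (e |: w)) S.
  by move=> hS e' w Se'; rewrite setUCA hS.
rewrite !IH //; [|exact: dep|exact: dep].
have [Pe|nPe] := pselect (P e).
  have /eq_Ex -> : (fun w => g (e |: w)) =1 g by move=> w; apply: gQ => /(PQ _ Pe).
  by ring.
have /eq_Ex -> : (fun w => f (e |: w)) =1 f by move=> w; apply: fP.
by ring.
Qed.

Lemma Pr_indep s A B P Q : depends_on A P -> depends_on B Q ->
  (forall e, P e -> Q e -> False) ->
  Pr s (fun w => A w && B w) = Pr s A * Pr s B.
Proof.
move=> AP BQ PQ; rewrite -(@Ex_indep s _ _ P Q) //.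
- by apply: eq_Ex => w; rewrite -natrM mulnb.
- by move=> e w /AP->.
- by move=> e w /BQ->.
Qed.

(** Serves twice: for the directions inside one search block, and for the source-target pairs of one
    family. *)
Lemma Pr_all_indep (I : eqType) (r : seq I) s (A : I -> {set T} -> bool)
    (P : I -> T -> Prop) (c : R) (N : nat) :
  uniq r -> {in r, forall i, depends_on (A i) (P i)} ->
  {in r &, forall i j, i != j -> forall e, P i e -> P j e -> False} ->
  {in r, forall i, Pr s (A i) <= c} -> 0 <= c <= 1 -> (N <= size r)%N ->
  Pr s (fun w => all (A^~ w) r) <= c ^+ N.
Proof.
move=> ur AP PP Ac /andP[c0 c1] Nr.
apply: (@le_trans _ _ (c ^+ size r)); last by apply: ler_wiXn2l.
elim: r ur AP PP Ac {Nr} => [|i r IH] /=.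
  by move=> _ _ _ _; rewrite /Pr Ex_const.
case/andP=> ir ur AP PP Ac.
have sub j : j \in r -> j \in i :: r by rewrite inE orbC => ->.
rewrite (@Pr_indep _ _ _ (P i) (fun e => exists2 j, j \in r & P j e)) //.
- rewrite exprS; apply: ler_pM; rewrite ?Pr_ge0 ?Ac ?mem_head //.
  by apply: IH => // [j /sub/AP|j k /sub jr /sub kr|j /sub/Ac] //; apply: PP.
- exact/AP/mem_head.
- move=> e w nP; apply: eq_in_all => j jr; apply: (AP _ (sub _ jr)) => Pje.
  by apply: nP; exists j.
- move=> e Pie [j jr Pje]; apply: (PP i j _ (sub _ jr) _ e) => //.
    exact: mem_head.
  by apply: contraNneq ir => ->.
Qed.

(** An inequality, because [l] may list an edge twice, which only makes the event likelier. *)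
Lemma Pr_all_open s (l : seq T) : {subset l <= s} -> p ^+ size l <= Pr s (fun w => all (mem w) l).
Proof.
have [p0 p1] := andP p01.
elim: l => [|e l IH] /= ls; first by rewrite /Pr Ex_const.
have {}IH : p ^+ size l <= Pr s (fun w => all (mem w) l).
  by apply: IH => x xl; apply: ls; rewrite inE xl orbT.
have pe : p <= Pr s (fun w => e \in w).
  have: e \in s by apply: ls; exact: mem_head.
  rewrite /Pr; elim: (s) => //= e' s' IHs; rewrite inE.
  case: eqP => [<- _|/eqP ee' /= /IHs {}IHs].
    have /eq_Ex -> : (fun w => (e \in e |: w)%:R : R) =1 fun=> 1.
      by move=> w; rewrite setU11.
    rewrite Ex_const mulr1 lerDl mulr_ge0 ?subr_ge0 //; exact: Pr_ge0.
  have /eq_Ex -> : (fun w => (e \in e' |: w)%:R : R) =1 fun w => (e \in w)%:R.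
    by move=> w; rewrite !inE (negbTE ee').
  by rewrite -mulrDl addrC subrK mul1r.
have [el|el] := boolP (e \in l).
  apply: (le_trans _ (le_trans IH _)); first by rewrite exprS ler_piMl ?exprn_ge0.
  by apply: le_Pr => w aw; rewrite aw andbT; apply: (allP aw).
rewrite (@Pr_indep _ _ _ (eq e) (fun e' => e' \in l)) //.
- by rewrite exprS; apply: ler_pM; rewrite ?exprn_ge0.
- by move=> e' w /eqP ne; rewrite !inE (negbTE ne).
- move=> e' w ne'; apply: eq_in_all => x xl /=; rewrite !inE.
  by case: eqP => // xe'; rewrite -xe' xl in ne'.
- by move=> e' <-; apply/negP.
Qed.

End BernoulliExpectation.

(** * The recursive search *)

Section Links.
Variables (R : realType) (n : nat) (p : R).
Hypothesis p01 : 0 <= p <= 1.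
Implicit Types (x y z u v : cube n) (i j k : 'I_n) (w : {set {set cube n}}).

Definition flip x i : cube n := [ffun k => x k (+) (k == i)].
Definition edge x i : {set cube n} := [set x; flip x i].
Notation walk_end := (foldl flip).

Fixpoint walk_edges x (l : seq 'I_n) : seq {set cube n} :=
  if l is i :: l' then edge x i :: walk_edges (flip x i) l' else [::].

Fixpoint walk_verts x (l : seq 'I_n) : seq (cube n) :=
  x :: (if l is i :: l' then walk_verts (flip x i) l' else [::]).

(* The walk l from x is not searched for directly: both of its ends are first
   moved along one common direction out of each block of Vs. *)
Fixpoint linked (l : seq 'I_n) (Vs : seq (seq 'I_n)) x w : bool :=
  if Vs is V :: Vs' then
    has (fun i => all (mem w) [:: edge x i; edge (walk_end x l) i] &&
                  linked l Vs' (flip x i) w) V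
  else all (mem w) (walk_edges x l).

Lemma flipK i : involutive (flip^~ i).
Proof. by move=> x; apply/ffunP => k; rewrite !ffunE -addbA addbb addbF. Qed.

Lemma flipC x i j : flip (flip x i) j = flip (flip x j) i.
Proof. by apply/ffunP => k; rewrite !ffunE -!addbA [(k == i) (+) _]addbC. Qed.

Lemma walk_end_flip x i l : walk_end (flip x i) l = flip (walk_end x l) i.
Proof. by elim: l x => //= j l IH x; rewrite flipC IH. Qed.

Lemma cube_adj_flip x i : cube_adj x (flip x i).
Proof.
rewrite /cube_adj (_ : [set _ | _] = [set i]) ?cards1 //.
by apply/setP => k; rewrite !inE ffunE; case: (x k); case: (k == i).
Qed.

Lemma cube_adjP x y : reflect (exists i, y = flip x i) (cube_adj x y).
Proof.
apply: (iffP idP) => [/cards1P[i xyi]|[i ->]]; last exact: cube_adj_flip.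
exists i; apply/ffunP => k; move/setP/(_ k): xyi; rewrite !inE ffunE => <-.
by case: (x k); case: (y k).
Qed.

Lemma edge_in_cube x i : edge x i \in cube_edges n.
Proof. by apply/imset2P; exists x (flip x i) => //; rewrite inE cube_adj_flip. Qed.

Lemma walk_edges_in_cube x l : {subset walk_edges x l <= enum (cube_edges n)}.
Proof.
elim: l x => //= i l IH x e; rewrite inE => /orP[/eqP->|/IH//].
by rewrite mem_enum edge_in_cube.
Qed.

Lemma size_walk_edges x l : size (walk_edges x l) = size l.
Proof. by elim: l x => //= i l IH x; rewrite IH. Qed.

Lemma mem_walk_end x l : walk_end x l \in walk_verts x l.
Proof. by elim: l x => [|i l IH] x /=; rewrite inE ?eqxx // IH orbT. Qed.

Lemma mem_walk_start x l : x \in walk_verts x l.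
Proof. by case: l => [|i l]; rewrite /= mem_head. Qed.

Lemma walk_verts_flip x i l : walk_verts (flip x i) l = [seq flip y i | y <- walk_verts x l].
Proof. by elim: l x => //= j l IH x; rewrite flipC IH. Qed.

Lemma walk_verts_agree x l k : k \notin l -> {in walk_verts x l, forall y, y k = x k}.
Proof.
elim: l x => [|j l IH] x /=; first by move=> _ y; rewrite inE => /eqP->.
rewrite inE negb_or => /andP[kj kl] y; rewrite inE => /orP[/eqP->//|/(IH _ kl)->].
by rewrite ffunE (negbTE kj) addbF.
Qed.

Lemma walk_edges_nonempty x l e : e \in walk_edges x l -> exists y, y \in e.
Proof.
elim: l x => //= i l IH x; rewrite inE => /orP[/eqP->|/IH//].
by exists x; rewrite !inE eqxx.
Qed.

Lemma edge_walk_verts x l e : e \in walk_edges x l -> forall y, y \in e -> y \in walk_verts x l.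
Proof.
elim: l x => //= i l IH x; rewrite inE => /orP[/eqP-> y|/IH H y /H]; last by rewrite inE orbC => ->.
by rewrite !inE => /orP[->//|/eqP->]; rewrite mem_walk_start orbT.
Qed.

(** Nonemptiness matters: the empty set would satisfy two incompatible vertex conditions at once and
    spoil the disjointness needed for independence. *)
Definition edge_within (Q : cube n -> Prop) (e : {set cube n}) :=
  (exists y, y \in e) /\ (forall y, y \in e -> Q y).

(** A search only inspects edges whose ends arise from the walk by flips along the blocks. *)
Lemma linked_depends l Vs x (Q : cube n -> Prop) :
  {in walk_verts x l, forall y, Q y} ->
  (forall i y, i \in flatten Vs -> Q y -> Q (flip y i)) ->
  depends_on (linked l Vs x) (edge_within Q).
Proof.
elim: Vs x => [|V Vs IH] x Qw Qf e w nQ /=.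
  apply: eq_in_all => e' e'w /=; rewrite !inE.
  case: eqP => // e'e; case: nQ; rewrite -e'e; split=> [|y /(edge_walk_verts e'w)/Qw//].
  exact: walk_edges_nonempty e'w.
have neq z i : Q z -> i \in V -> edge z i != e.
  move=> Qz iV; apply/eqP => ee; apply: nQ; rewrite -ee; split=> [|y].
    by exists z; rewrite !inE eqxx.
  rewrite !inE => /orP[]/eqP-> //.
  by apply: Qf => //=; rewrite mem_cat iV.
apply: eq_in_has => i iV /=; rewrite !inE.
rewrite (negbTE (neq x i _ iV)) ?(negbTE (neq (walk_end x l) i _ iV)) //=; last first.
- exact/Qw/mem_walk_start.
- exact/Qw/mem_walk_end.
congr (_ && _); apply: IH => // [y|j y jVs]; last by apply: Qf; rewrite /= mem_cat jVs orbT.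
rewrite walk_verts_flip => /mapP[z /Qw Qz ->]; apply: Qf => //.
by rewrite /= mem_cat iV.
Qed.

(* h bounds the length of the walk, N is the size of the blocks, m their number. *)
Fixpoint fail_bound (N h m : nat) : R :=
  if m is m'.+1 then (1 - p ^+ 2 * (1 - fail_bound N h m')) ^+ N else 1 - p ^+ h.

Lemma fail_bound01 N h m : 0 <= fail_bound N h m <= 1.
Proof.
have [p0 p1] := andP p01.
elim: m => [|m /andP[IH0 IH1]] /=.
  by rewrite subr_ge0 exprn_ile1 //= lerBlDr lerDl exprn_ge0.
have q0 : 0 <= p ^+ 2 * (1 - fail_bound N h m) by rewrite mulr_ge0 ?exprn_ge0 // subr_ge0.
have q1 : p ^+ 2 * (1 - fail_bound N h m) <= 1.
  by rewrite mulr_ile1 ?exprn_ge0 ?exprn_ile1 // ?subr_ge0 // lerBlDr lerDl.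
by rewrite exprn_ge0 ?subr_ge0 //= exprn_ile1 ?subr_ge0 // lerBlDr lerDl.
Qed.

(** The coordinates in the first block [V] separate the attempts: after its first step, the attempt
    through [i] only visits vertices that differ from [x] on [V] exactly at [i]. Hence distinct
    attempts share no edge. The two edges in direction [i] each have an end agreeing with [x] at
    [i], so they are independent of the inner search. *)
Lemma Pr_linked (N h : nat) l Vs x : (size l <= h)%N ->
  uniq (flatten Vs) -> {in flatten Vs, forall k, k \notin l} ->
  all (fun V => N <= size V)%N Vs ->
  Pr p (enum (cube_edges n)) (fun w => ~~ linked l Vs x w) <= fail_bound N h (size Vs).
Proof.
have [p0 p1] := andP p01; move=> lh.
elim: Vs x => [|V Vs IH] x uVs Vl sVs /=.
  rewrite PrN // lerD2l lerN2; apply: le_trans (Pr_all_open p01 (@walk_edges_in_cube x l)).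
  by rewrite size_walk_edges; apply: ler_wiXn2l.
move: uVs; rewrite /= cat_uniq => /and3P[uV VVs uVs].
have /andP[sV {}sVs] := sVs.
have Vl' : {in V, forall k, k \notin l} by move=> k kV; apply: Vl; rewrite /= mem_cat kV.
have VVs' k : k \in flatten Vs -> k \notin V.
  by move=> kVs; apply: contra VVs => kV; apply/hasP; exists k.
have /eq_Ex E : (fun w => (~~ has (fun i => all (mem w) [:: edge x i; edge (walk_end x l) i] &&
                  linked l Vs (flip x i) w) V)%:R : R) =1
  fun w => (all (fun i => ~~ (all (mem w) [:: edge x i; edge (walk_end x l) i] &&
                  linked l Vs (flip x i) w)) V)%:R.
  by move=> w; rewrite -all_predC.
rewrite {1}/Pr E; clear E.
pose A i w := all (mem w) [:: edge x i; edge (walk_end x l) i].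
(* Some end is flipped at [i] and no end is flipped elsewhere on [V]; this covers both the two edges
   in direction [i] and the inner search. *)
pose P i (e : {set cube n}) := (exists2 y, y \in e & y i != x i) /\
  (forall y k, y \in e -> k \in V -> k != i -> y k = x k).
have off i : i \in V -> {in walk_verts (flip x i) l, forall y, forall k, k \in V ->
    y k = x k (+) (k == i)}.
  by move=> iV y yw k kV; rewrite (walk_verts_agree (Vl' k kV) yw) ffunE.
have depL i : i \in V -> depends_on (linked l Vs (flip x i))
    (edge_within (fun y => forall k, k \in V -> y k = x k (+) (k == i))).
  move=> iV; apply: linked_depends => [|j y jVs Qy k kV]; first exact: off.
  rewrite ffunE Qy // (_ : k == j = false) ?addbF //.
  by apply: contraNF (VVs' j jVs) => /eqP<-.
have endV k : k \in V -> walk_end x l k = x k.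
  by move=> kV; apply: (walk_verts_agree (Vl' k kV)); apply: mem_walk_end.
have depA i : depends_on (A i) (fun e => e = edge x i \/ e = edge (walk_end x l) i).
  move=> e w ne; rewrite /A /= !inE; have [eE|_] := eqVneq (edge x i) e.
    by case: ne; left.
  by have [eE|_//] := eqVneq _ e; case: ne; right.
apply: (@Pr_all_indep _ _ _ p01 _ V _ (fun i w => ~~ (A i w && linked l Vs (flip x i) w)) P) => //.
- move=> i iV e w nP; rewrite depA ?depL //.
    move=> [[y ye] eP]; apply: nP; split; first by exists y => //; rewrite (eP y ye i iV) eqxx addbT; case: (x i).
    by move=> z k ze kV ki; rewrite eP // (negbTE ki) addbF.
  case=> eE; apply: nP; rewrite eE; split.
  + exists (flip x i); first by rewrite !inE eqxx orbT.
    by rewrite ffunE eqxx addbT; case: (x i).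
  + move=> y k; rewrite !inE => /orP[]/eqP-> kV ki //.
    by rewrite ffunE (negbTE ki) addbF.
  + exists (flip (walk_end x l) i); first by rewrite !inE eqxx orbT.
    by rewrite ffunE endV // eqxx addbT; case: (x i).
  + move=> y k; rewrite !inE => /orP[]/eqP-> kV ki; rewrite ?endV //.
    by rewrite ffunE (negbTE ki) addbF endV.
- move=> i j iV jV ij e [[y ye yi] _] [_ /(_ y i ye iV ij)] yi'.
  by rewrite yi' eqxx in yi.
- move=> i iV; rewrite PrN // lerD2l lerN2.
  rewrite (Pr_indep _ _ (depA i) (depL i iV)).
    apply: ler_pM; rewrite ?exprn_ge0 // ?subr_ge0.
    + by case/andP: (fail_bound01 N h (size Vs)).
    + apply: (@Pr_all_open _ _ _ p01 _ [:: _; _]) => e; rewrite !inE.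
      by case/orP=> /eqP->; rewrite mem_enum edge_in_cube.
    + rewrite lerBlDr addrC -lerBlDr -PrN //; apply: IH => // k kVs.
      by apply: Vl; rewrite /= mem_cat kVs orbT.
  move=> e eE [_ H].
  have [y ye yi] : exists2 y, y \in e & y i = x i.
    case: eE => ->; [exists x|exists (walk_end x l)]; rewrite ?endV //.
      by rewrite !inE eqxx.
    by rewrite !inE eqxx.
  by have := H y ye i iV; rewrite yi eqxx addbT; case: (x i).
- have [q0 q1] := andP (fail_bound01 N h (size Vs)).
  rewrite subr_ge0 mulr_ile1 ?exprn_ge0 ?exprn_ile1 ?subr_ge0 //=; last by rewrite lerBlDr lerDl.
  by rewrite lerBlDr lerDl mulr_ge0 ?exprn_ge0 ?subr_ge0.
Qed.

End Links.

(** * Reachability in a bounded number of steps *)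

Section Reach.
Variables (T : finType) (e : rel T).

Lemma reachSP x z k : z \in reach e x k.+1 ->
  z \in reach e x k \/ exists2 y, y \in reach e x k & e y z.
Proof.
rewrite /= !inE => /orP[|/existsP[y /andP[]]]; first by left.
by right; exists y.
Qed.

Lemma reach_le x k l : (k <= l)%N -> reach e x k \subset reach e x l.
Proof.
move/subnK <-; elim: (l - k)%N => //= j IH.
exact: (subset_trans IH (subsetUl _ _)).
Qed.

Lemma reach_step x y k z : y \in reach e x k -> e y z -> z \in reach e x k.+1.
Proof.
by move=> yx yz; rewrite /= !inE; apply/orP; right; apply/existsP; exists y; rewrite yx.
Qed.

Lemma reach_trans x y z k l :
  y \in reach e x k -> z \in reach e y l -> z \in reach e x (k + l).
Proof.
move=> yx; elim: l z => [|l IH] z; first by rewrite inE addn0 => /eqP->.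
case/reachSP=> [/IH|[t /IH tx tz]]; first by apply/fintype.subsetP/reach_le; rewrite addnS.
rewrite addnS.
exact: reach_step tx tz.
Qed.

Lemma reach1 x y : e x y -> y \in reach e x 1.
Proof. by apply: (@reach_step x x 0); rewrite inE. Qed.

Lemma reach_sym x y k : symmetric e -> y \in reach e x k -> x \in reach e y k.
Proof.
move=> es; elim: k y => [|k IH] y; first by rewrite !inE eq_sym.
case/reachSP=> [/IH|[t /IH tx ty]]; first by apply/fintype.subsetP/reach_le.
by rewrite -[k.+1]add1n; apply: (@reach_trans y t); rewrite // reach1 // es.
Qed.

End Reach.

Lemma reach_lipschitz (T T' : finType) (e : rel T) (e' : rel T') (f : T -> T') L x y k :
  (forall a b, e a b -> f b \in reach e' (f a) L) ->
  y \in reach e x k -> f y \in reach e' (f x) (L * k).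
Proof.
move=> fL; elim: k y => [|k IH] y; first by rewrite inE muln0 => /eqP->; rewrite inE.
case/reachSP=> [/IH|[t /IH tx ty]].
  by apply/fintype.subsetP/reach_le; rewrite leq_mul2l leqnSn orbT.
rewrite mulnS addnC.
exact: reach_trans tx (fL _ _ ty).
Qed.

Lemma cube_adj_sym n : symmetric (@cube_adj n).
Proof.
move=> x y; rewrite /cube_adj; congr (_ == _); apply: eq_card => k.
by rewrite !inE eq_sym.
Qed.

Lemma perc_adj_sym n (w : {set {set cube n}}) : symmetric (perc_adj w).
Proof. by move=> x y; rewrite /perc_adj cube_adj_sym finset.setUC. Qed.

(** Each block lengthens the path by one step at either end; both steps have the same direction, so
    the endpoint is unchanged. *)
Lemma linked_reach n l Vs (x : cube n) w : linked l Vs x w ->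
  foldl (@flip n) x l \in reach (perc_adj w) x (size l + 2 * size Vs).
Proof.
have open_step (y : cube n) i : edge y i \in w -> perc_adj w y (flip y i).
  by move=> yi; rewrite /perc_adj cube_adj_flip.
elim: Vs x => [|V Vs IH] x.
  rewrite muln0 addn0; elim: l x => [|i l IH] x; first by rewrite inE.
  case/andP=> xi /IH xl; rewrite (_ : size (i :: l) = 1 + size l)%N //.
  by apply: reach_trans xl; apply/reach1/open_step.
case/hasP=> i _ /andP[/and3P[xi yi _] /IH]; rewrite walk_end_flip => xy.
have -> : (size l + 2 * size (V :: Vs) = 1 + (size l + 2 * size Vs).+1)%N by rewrite /=; lia.
apply: reach_trans (reach1 (open_step _ _ xi)) _.
apply: reach_step xy _.
by rewrite perc_adj_sym open_step.
Qed.

(** * Sources and targets around a vertex *)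

Section Codes.
Variables (n N m : nat) (c : nat -> nat -> 'I_n).
(* c r s is the coordinate number s of block r: blocks 0, 1 carry the sources,
   blocks 2, 3 the targets, and the remaining m blocks serve the search. *)
Hypothesis c_eq : forall r s r' s', (r < m + 4)%N -> (r' < m + 4)%N -> (s <= N)%N -> (s' <= N)%N ->
  (c r s == c r' s') = (r == r') && (s == s').
Local Notation code := ('I_N * 'I_N)%type.
Implicit Types (x y : cube n) (d : option 'I_n) (a b : code) (w : {set {set cube n}}).

Definition shift x d : cube n := if d is Some i then flip x i else x.
Definition codepoint x (r : nat) a : cube n := flip (flip x (c r a.1)) (c r.+1 a.2).
(** Blocks start with N + 1 coordinates so that at least N are left once [d], which belongs to the
    route, is removed. *)
Definition blocks d : seq (seq 'I_n) :=
  [seq [seq k <- [seq c r s | s <- iota 0 N.+1] | Some k != d] | r <- iota 4 m].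
(** The target is written before the source is erased, so every vertex on the way shows a whole
    source or a whole target. *)
Definition route d a a' : seq 'I_n :=
  [:: c 2 a'.1; c 3 a'.2; c 0 a.1; c 1 a.2] ++ seq_of_opt d.
Definition code_link x d a a' w : bool := linked (route d a a') (blocks d) (codepoint x 0 a) w.

Lemma route_end x d a a' :
  foldl (@flip n) (codepoint x 0 a) (route d a a') = codepoint (shift x d) 2 a'.
Proof.
rewrite foldl_cat; apply/ffunP => k; case: d => [d|] /=; rewrite !ffunE.
  by case: (x k); do 5!case: (k == _).
by case: (x k); do 4!case: (k == _).
Qed.

Lemma size_route d a a' : (size (route d a a') <= 5)%N.
Proof. by case: d. Qed.

Lemma size_blocks d : size (blocks d) = m.
Proof. by rewrite size_map size_iota. Qed.

Lemma blocks_filter d : flatten (blocks d) =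
  [seq k <- [seq c r s | r <- iota 4 m, s <- iota 0 N.+1] | Some k != d].
Proof. by rewrite filter_flatten -map_comp. Qed.

Lemma mem_blocks d k : k \in flatten (blocks d) ->
  Some k != d /\ exists r s, [/\ k = c r s, (4 <= r < m + 4)%N & (s <= N)%N].
Proof.
rewrite blocks_filter mem_filter => /andP[-> /allpairsP[[r s] [/= rI sI ->]]].
split=> //; exists r, s; move: rI sI; rewrite mem_iota (mem_iota 0 N.+1) => rI sI.
by split=> //; lia.
Qed.

Lemma uniq_blocks d : uniq (flatten (blocks d)).
Proof.
rewrite blocks_filter filter_uniq // allpairs_uniq ?iota_uniq //.
move=> _ _ /allpairsP[[r s] [rI sI ->]] /allpairsP[[r' s'] [rI' sI' ->]] /eqP.
move: rI sI rI' sI'; rewrite !mem_iota => /= rI sI rI' sI'.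
rewrite c_eq; [|lia..].
by case/andP=> /eqP-> /eqP->.
Qed.

Lemma size_block d : all (fun V => N <= size V)%N (blocks d).
Proof.
apply/allP => V /mapP[r]; rewrite mem_iota => r4 ->.
set s := map _ _; have us : uniq s.
  rewrite map_inj_in_uniq ?iota_uniq // => i j; rewrite !mem_iota => ? ? /eqP.
  by rewrite c_eq; [case/andP=> _ /eqP|lia..].
have : (count (fun k => Some k == d) s <= 1)%N.
  case: d => [d|]; last by rewrite count_pred0.
  rewrite (eq_count (_ : _ =1 pred1 d)) ?count_uniq_mem ?leq_b1 //.
have : size s = N.+1 by rewrite size_map size_iota.
rewrite size_filter -(count_predC (fun k => Some k != d) s).
rewrite (@eq_count _ (predC _) (fun k => Some k == d)) => [|k]; last by rewrite /= negbK.
by set u := count _ _; set v := count _ _; lia.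
Qed.

(* The vertices of a search agree on blocks 0 to 3 with a vertex of its route.
   A vertex of the route either still shows the whole source a on blocks 0, 1
   (near_source), or has at most one flipped coordinate there and shows the whole
   target a' on blocks 2, 3, up to the flip of the coordinate d (near_target). *)
Definition near_source x a y := forall r s, (r < 2)%N -> (s <= N)%N ->
  y (c r s) = x (c r s) (+) ((r == 0) && (s == a.1)) (+) ((r == 1)%N && (s == a.2)).

Definition near_target x d a' y :=
  (exists u : option 'I_n, forall r s, (r < 2)%N -> (s <= N)%N ->
    y (c r s) = x (c r s) (+) (Some (c r s) == u)) /\
  (exists t : bool, forall r s, (1 < r < 4)%N -> (s <= N)%N ->
    y (c r s) = x (c r s) (+) ((r == 2) && (s == a'.1)) (+) ((r == 3) && (s == a'.2))
                (+) (t && (Some (c r s) == d))).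

Definition near_route x d a a' y := near_source x a y \/ near_target x d a' y.

(** A source flips one coordinate in each of blocks 0 and 1, which is incompatible with at most one
    flip there. So both routes show their source at [y], or both show their target, and reading it
    off gives [a = b] or [a' = b']. *)
Lemma near_route_disjoint x d a a' b b' y : a != b -> a' != b' ->
  near_route x d a a' y -> near_route x d b b' y -> False.
Proof.
have leN (i : 'I_N) : (i <= N)%N by apply: ltnW.
have st a1 b1' : near_source x a1 y -> near_target x d b1' y -> False.
  move=> S [[u O] _].
  have := O 0 a1.1 isT (leN _); have := O 1%N a1.2 isT (leN _).
  rewrite !S // !eqxx /= !addbF.
  case: eqP => [<- _|_]; last by case: (x _).
  case: eqP => [/Some_inj/eqP|_]; last by case: (x _).
  by rewrite c_eq //; lia.
case: a b a' b' => [a1 a2] [b1 b2] [a3 a4] [b3 b4] ab ab'.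
move=> [S|S] [S'|S']; [|exact: st S S'|exact: st S' S|].
  have := S 0 a1 isT (leN _); have := S 1%N a2 isT (leN _).
  rewrite !S' //= !eqxx /= !addbF.
  case: eqP => [/val_inj a2b _|_]; last by case: (x _).
  case: eqP => [/val_inj a1b|_]; last by case: (x _).
  by rewrite a1b a2b eqxx in ab.
case: S S' => [_ [t S]] [_ [t' S']].
(* Distinct [i] and [j] would give a discrepancy at two coordinates of block [r], while the flips at
   [d] account for at most one. *)
have key r (i j : 'I_N) : (1 < r < 4)%N ->
  (forall s, (s <= N)%N -> (s == i) (+) (t && (Some (c r s) == d)) =
             (s == j) (+) (t' && (Some (c r s) == d))) -> i = j.
  move=> r4 H; apply/eqP; apply/negPn/negP => ij.
  have := H i (leN i); have := H j (leN j).
  rewrite !eqxx -!(inj_eq val_inj) /= in ij *; rewrite eq_sym (negbTE ij).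
  case: (eqVneq (Some (c r j)) d) => [<-|_]; last by case: (t); case: (t').
  have -> : (Some (c r i) == Some (c r j)) = false.
    by apply/negP => /eqP/Some_inj/eqP; rewrite c_eq ?leN // ?eqxx ?(negbTE ij) //; lia.
  by case: (t); case: (t').
have E3 : a3 = b3.
  apply: (key 2) => // s sN; have := S 2 s isT sN; rewrite S' //= !addbF.
  by case: (x _); case: (s == _); case: (s == _); case: (_ == d); case: (t); case: (t').
have E4 : a4 = b4.
  apply: (key 3) => // s sN; have := S 3 s isT sN; rewrite S' //= !addbF.
  by case: (x _); case: (s == _); case: (s == _); case: (_ == d); case: (t); case: (t').
by rewrite E3 E4 eqxx in ab'.
Qed.

Lemma near_route_flip x d a a' i y : i \in flatten (blocks d) ->
  near_route x d a a' y -> near_route x d a a' (flip y i).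
Proof.
case/mem_blocks=> _ [r [s [-> r4 sN]]].
have fix_low r' s' : (r' < 4)%N -> (s' <= N)%N -> flip y (c r s) (c r' s') = y (c r' s').
  move=> r'4 s'N; rewrite ffunE c_eq; [|lia..].
  by rewrite (_ : (r' == r) = false) ?addbF //; lia.
case=> [S|[[u O] [t S]]]; [left|right; split; [exists u|exists t]] => r' s' r'b s'N.
- by rewrite fix_low ?S //; lia.
- by rewrite fix_low ?O //; lia.
- by rewrite fix_low ?S //; lia.
Qed.

Local Ltac bits r r2 x s := case: r r2 => [|[|[|[|]]]] //= _; rewrite ?addbF //=;
  try by case: (x _); case: (s == _).

Lemma near_route_walk x d a a' :
  {in walk_verts (codepoint x 0 a) (route d a a'), forall y, near_route x d a a' y}.
Proof.
case: a a' => [a1 a2] [a3 a4].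
have leN (i : 'I_N) : (i <= N)%N by apply: ltnW.
have E r s r' (i : 'I_N) : (r < 4)%N -> (r' < 4)%N -> (s <= N)%N ->
  (c r s == c r' i) = (r == r') && (s == i).
  by move=> *; apply: c_eq => //; lia.
have main : {in walk_verts (codepoint x 0 (a1, a2)) (route None (a1, a2) (a3, a4)),
    forall y, near_route x d (a1, a2) (a3, a4) y}.
  move=> y /=; rewrite !inE.
  case/or4P=> [/eqP->|/eqP->|/eqP->|/orP[]/eqP->].
  - by left=> r s r2 sN; rewrite !ffunE !E; [|lia..]; bits r r2 x s.
  - by left=> r s r2 sN; rewrite !ffunE !E; [|lia..]; bits r r2 x s.
  - by left=> r s r2 sN; rewrite !ffunE !E; [|lia..]; bits r r2 x s.
  - right; split; [exists (Some (c 1 a2))|exists false] => r s r2 sN.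
      by rewrite !ffunE (inj_eq Some_inj) !E; [|lia..]; bits r r2 x s.
    by rewrite !ffunE !E; [|lia..]; bits r r2 x s.
  - right; split; [exists None|exists false] => r s r2 sN.
      by rewrite !ffunE !E; [|lia..]; bits r r2 x s.
    by rewrite !ffunE !E; [|lia..]; bits r r2 x s.
case: d main => [d|] main y; last exact: main.
rewrite /= !inE => yv.
have [|ym] := boolP (y \in walk_verts (codepoint x 0 (a1, a2)) (route None (a1, a2) (a3, a4))).
  exact: main.
(* The only new vertex is the end of the route, the target flipped at [d]; hence the witnesses
   [Some d] and [true]. *)
have /eqP-> : y == flip (codepoint x 2 (a3, a4)) d.
  rewrite /= !inE !negb_or in ym; case/and5P: ym => n1 n2 n3 n4 n5.
  move: yv; rewrite (negbTE n1) (negbTE n2) (negbTE n3) (negbTE n4) (negbTE n5) /= => /eqP->.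
  by apply/eqP; congr (flip _ _); exact: (route_end x None (a1, a2) (a3, a4)).
right; split; [exists (Some d)|exists true] => r s r2 sN.
  by rewrite !ffunE (inj_eq Some_inj) !E; [|lia..]; bits r r2 x s.
by rewrite !ffunE (inj_eq Some_inj) !E; [|lia..]; bits r r2 x s.
Qed.

Lemma route_blocks d a a' : {in flatten (blocks d), forall k, k \notin route d a a'}.
Proof.
move=> k /mem_blocks[kd [r [s [kE r4 sN]]]].
have leN (i : 'I_N) : (i <= N)%N by apply: ltnW.
rewrite /route mem_cat negb_or; apply/andP; split.
  by rewrite !inE kE !c_eq //; lia.
by case: d kd => [d|] //=; rewrite (inj_eq Some_inj) inE.
Qed.

Section CodeProbability.
Variables (R : realType) (p : R).
Hypothesis p01 : 0 <= p <= 1.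

Lemma Pr_no_code_link x d (f g : 'I_N -> code) : injective f -> injective g ->
  Pr p (enum (cube_edges n))
    (fun w => all (fun t => ~~ code_link x d (f t) (g t) w) (enum 'I_N))
  <= fail_bound p N 5 m ^+ N.
Proof.
move=> fI gI.
apply: (@Pr_all_indep _ _ _ p01 _ (enum 'I_N) _ (fun t w => ~~ code_link x d (f t) (g t) w)
  (fun t => edge_within (near_route x d (f t) (g t)))).
- exact: enum_uniq.
- move=> t _ e w nQ; congr (~~ _); apply: linked_depends nQ.
    exact: near_route_walk.
  by move=> i y; apply: near_route_flip.
- move=> t t' _ _ tt' e [[y ye] Q] [_ Q'].
  by apply: near_route_disjoint (Q y ye) (Q' y ye); rewrite inj_eq.
- move=> t _; rewrite -[in X in _ <= X](size_blocks d); apply: Pr_linked => //.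
  + exact: size_route.
  + exact: uniq_blocks.
  + exact: route_blocks.
  + exact: size_block.
- exact: fail_bound01.
- by rewrite size_enum_ord.
Qed.

Local Notation family :=
  (cube n * option 'I_n * {ffun 'I_N -> code} * {ffun 'I_N -> code})%type.

Definition unlinked_family (F : family) w : bool :=
  let: (x, d, f, g) := F in
  [&& injectiveb f, injectiveb g &
      all (fun t => ~~ code_link x d (f t) (g t) w) (enum 'I_N)].

Definition well_linked w : bool := [forall F, ~~ unlinked_family F w].

Lemma Pr_not_well_linked :
  Pr p (enum (cube_edges n)) (fun w => ~~ well_linked w) <=
  (2 ^ n * n.+1 * (N * N) ^ N * (N * N) ^ N)%:R * fail_bound p N 5 m ^+ N.
Proof.
have [q0 _] := andP (fail_bound01 p01 N 5 m).
apply: (le_trans (Pr_union p01 _ (B := unlinked_family) _)).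
  by move=> w; rewrite negb_forall => /existsP[F]; rewrite negbK; exists F.
apply: (@le_trans _ _ (\sum_(F : family) fail_bound p N 5 m ^+ N)).
  apply: ler_sum => -[[[x d] f] g] _.
  (* Families with a repeated source or target contribute the empty event. *)
  have vacuous (A : {set {set cube n}} -> bool) : (forall w, A w -> false) ->
      Pr p (enum (cube_edges n)) A <= fail_bound p N 5 m ^+ N.
    move=> A0; apply: le_trans (le_Pr p01 _ (B := xpred0) A0) _.
    by rewrite /Pr Ex_const exprn_ge0.
  have [fI|fI] := boolP (injectiveb f); last first.
    by apply: vacuous => w /and3P[]; rewrite (negbTE fI).
  have [gI|gI] := boolP (injectiveb g); last first.
    by apply: vacuous => w /and3P[_]; rewrite (negbTE gI).
  apply: le_trans (Pr_no_code_link x d (injectiveP _ fI) (injectiveP _ gI)).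
  by apply: le_Pr => // w /and3P[].
rewrite sumr_const !card_prod card_option !card_ffun !card_prod !card_ord card_bool.
by rewrite mulr_natl.
Qed.

End CodeProbability.

End Codes.

Lemma leq_card_bigcup (T I : finType) (S : {set I}) (F : I -> {set T}) k :
  {in S, forall i, #|F i| <= k}%N -> (#|\bigcup_(i in S) F i| <= #|S| * k)%N.
Proof.
move=> Fk; apply: (@leq_trans (\sum_(i in S) k)); last by rewrite sum_nat_const.
apply: (big_rec2 (fun (A : {set T}) s => #|A| <= s)%N); first by rewrite cards0.
move=> i s A iS As; apply: leq_trans (leq_add (Fk i iS) As).
exact: leq_card_setU.
Qed.

(** * The embedding *)

Section Embedding.
Variables (n N m : nat) (c : nat -> nat -> 'I_n) (w : {set {set cube n}}).
Hypothesis Lw : well_linked N m c w.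
Local Notation code := ('I_N * 'I_N)%type.
Implicit Types (x y : cube n) (d : option 'I_n) (S : {set code}).
Local Notation radius := (5 + 2 * m)%N.

Lemma well_linked_exists x d (S S' : {set code}) : (N <= #|S|)%N -> (N <= #|S'|)%N ->
  exists2 a, a \in S & exists2 a', a' \in S' & code_link m c x d a a' w.
Proof.
move=> NS NS'.
pose pick (A : {set code}) (NA : (N <= #|A|)%N) : {ffun 'I_N -> code} :=
  [ffun t => enum_val (widen_ord NA t)].
have pickI A NA : injective (@pick A NA).
  by move=> s t; rewrite !ffunE => /enum_val_inj/(congr1 val)/= /val_inj.
have pickA A NA t : @pick A NA t \in A by rewrite ffunE enum_valP.
have := forallP Lw (x, d, pick S NS, pick S' NS').
rewrite /unlinked_family !negb_and; case/or3P.
- by move/injectivePn=> [s [t st /pickI]] /eqP; rewrite (negbTE st).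
- by move/injectivePn=> [s [t st /pickI]] /eqP; rewrite (negbTE st).
rewrite -has_predC => /hasP[t _]; rewrite /= negbK => lt.
by exists (pick S NS t) => //; exists (pick S' NS' t).
Qed.

Definition neighbours x a : {set code} := [set a' | code_link m c x None a a' w].

(* N vertices of degree less than N would miss at least N of the N * N targets. *)
Lemma rich_code x : exists a, (N <= #|neighbours x a|)%N.
Proof.
apply: contrapT => /forallNP poor.
have {}poor a : (#|neighbours x a| <= N.-1)%N.
  by have /negP := poor a; rewrite -ltnNge; lia.
have [N0|N0] := posnP N.
  have N0' : (N <= #|set0 : {set code}|)%N by rewrite N0.
  by have [[[i iN] _] _ _] := well_linked_exists x None N0' N0'; rewrite N0 in iN.
pose S : {set code} := [set (Ordinal N0, j) | j : 'I_N].
have cS : #|S| = N by rewrite card_imset ?card_ord // => i j [].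
pose U := \bigcup_(a in S) neighbours x a.
have cU : (#|U| <= N * N.-1)%N.
  by rewrite -[X in (_ <= X * _)%N]cS; apply: leq_card_bigcup => a _.
have cT : (N <= #|~: U|)%N.
  have := cardsC U; rewrite card_prod card_ord.
  by move: cU; rewrite -subn1 mulnBr muln1; nia.
have [|a aS [a' a'U al]] := @well_linked_exists x None S (~: U) _ cT.
  by rewrite cS.
move: a'U; rewrite inE => /negP; apply; apply/bigcupP; exists a => //.
by rewrite inE.
Qed.

Lemma code_link_reach x d (a a' : code) : code_link m c x d a a' w ->
  codepoint c (shift x d) 2 a' \in reach (perc_adj w) (codepoint c x 0 a) radius.
Proof.
move/linked_reach; rewrite route_end size_blocks.
by apply/fintype.subsetP/reach_le; rewrite leq_add2r size_route.
Qed.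

Lemma well_linked_embedding : exists f : cube n -> cube n,
  (forall x, f x \in reach (@cube_adj n) x 2) /\
  (forall x y, cube_adj x y -> f y \in reach (perc_adj w) (f x) (4 * radius)).
Proof.
have [a_ rich] := fin_all_exists rich_code.
exists (fun x => codepoint c x 0 (a_ x)); split=> [x|x y /cube_adjP[i ->]].
  apply: (@reach_trans _ _ _ (flip x (c 0 (a_ x).1)) _ 1 1); apply/reach1/cube_adj_flip.
set y' := flip x i.
(* The sources of [y'] linked to a target of [x] that is joined to the image of [x]; note that
   [shift y' (Some i)] is [x]. *)
pose P : {set code} :=
  [set a | [exists a' in neighbours x (a_ x), code_link m c y' (Some i) a a' w]].
(* If N sources lay outside [P], one of them would be linked to one of the at least N targets in
   [neighbours x (a_ x)]. So fewer than N do, and N^2 - N + 1 >= N. *)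
have cP : (N <= #|P|)%N.
  have [NC|NC] := leqP N #|~: P|.
    have [a aP [a' a'x al]] := well_linked_exists y' (Some i) NC (rich x).
    move: aP; rewrite !inE => /negP[]; apply/existsP; exists a'.
    by rewrite a'x.
  have := cardsC P; rewrite card_prod card_ord.
  by move: NC; nia.
have [a aP [a' a'y al]] := well_linked_exists y' None cP (rich y').
move: aP; rewrite inE => /existsP[s /andP[sx sa]].
have psym u v k : v \in reach (perc_adj w) u k -> u \in reach (perc_adj w) v k.
  exact/reach_sym/perc_adj_sym.
rewrite inE in sx; rewrite inE in a'y.
have r1 := code_link_reach sx.
have := code_link_reach sa; rewrite (_ : shift _ _ = x) => [/psym r2|]; last exact: flipK.
have r3 := code_link_reach al.
have r4 := psym _ _ _ (code_link_reach a'y).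
by have := reach_trans (reach_trans r1 r2) (reach_trans r3 r4); rewrite addnn addnn -!muln2 -mulnA mulnC.
Qed.

End Embedding.

(** * From a map with short steps to a distortion bound *)

Section Distance.
Variables (T : finType) (e : rel T).

Lemma gdist_reach x y h : gdist e x y = Some h ->
  y \in reach e x h /\ forall k, y \in reach e x k -> (h <= k)%N.
Proof.
rewrite /gdist; set P := (X in find X _); set s := iota 0 #|T|.
case: ifP => // fT [hE].
have szs : size s = #|T| by rewrite size_iota.
have hasP' : has P s by rewrite has_find szs.
split; first by have := nth_find 0%N hasP'; rewrite nth_iota // add0n hE.
move=> k yk; rewrite leqNgt -hE; apply/negP => kf.
have := before_find 0%N kf; rewrite nth_iota ?add0n; last exact: ltn_trans kf fT.
by rewrite /P yk.
Qed.

(** [gdist] only tries lengths below [#|T|], hence the bound on [k]. *)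
Lemma reach_gdist x y k : y \in reach e x k -> (k < #|T|)%N ->
  exists2 h, gdist e x y = Some h & (h <= k)%N.
Proof.
move=> yk kT; rewrite /gdist; set P := (X in find X _); set s := iota 0 #|T|.
have szs : size s = #|T| by rewrite size_iota.
have hP : has P s by apply/hasP; exists k; rewrite // mem_iota.
rewrite -szs -has_find hP; exists (find P s) => //.
rewrite leqNgt; apply/negP => kf.
by have := before_find 0%N kf; rewrite nth_iota // add0n /P yk.
Qed.

End Distance.

Lemma cube_reach n (x y : cube n) : y \in reach (@cube_adj n) x n.
Proof.
suff H : y \in reach (@cube_adj n) x #|[set i | x i != y i]|.
  by apply: (fintype.subsetP (reach_le _ _ _)) H; rewrite -[X in (_ <= X)%N]card_ord max_card.
move: {2}#|_| (erefl #|[set i | x i != y i]|) => k.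
elim: k x => [|k IH] x xy.
  rewrite xy inE eq_sym; apply/eqP/ffunP => i; apply/eqP; rewrite -[_ == _]negbK.
  by apply/negP => xi; have := cards0_eq xy => /setP/(_ i); rewrite !inE xi.
have [i] : exists i, i \in [set i | x i != y i] by apply/card_gt0P; rewrite xy.
rewrite inE => xi.
have E : [set j | flip x i j != y j] = [set j | x j != y j] :\ i.
  apply/setP => j; rewrite !inE ffunE; have [->|_] := eqVneq j i; last by rewrite addbF.
  by move: xi; case: (x i); case: (y i).
have xyi : #|[set j | flip x i j != y j]| = k.
  by have := cardsD1 i [set j | x j != y j]; rewrite xy inE xi E; lia.
rewrite xy -add1n; apply: reach_trans (reach1 (cube_adj_flip x i)) _.
by have := IH _ xyi; rewrite xyi.
Qed.

(** [L * n < 2 ^ n] keeps all paths within the range tried by [gdist]. Cube edges go to paths of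
    length at most [L], so D_+ <= L. An open path of length k between the images yields a cube path
    of length k + 4 between the points, and k + 4 <= 5 max(1, k) gives D_- >= 1/5. *)
Lemma cube_distortion_le (R : realType) n (w : {set {set cube n}}) (f : cube n -> cube n) L :
  (0 < L)%N -> (L * n < 2 ^ n)%N ->
  (forall x, f x \in reach (@cube_adj n) x 2) ->
  (forall x y, cube_adj x y -> f y \in reach (perc_adj w) (f x) L) ->
  (cube_perc_distortion R w <= (5 * L)%:R%:E)%E.
Proof.
move=> L0 Ln near lip.
have cT : #|{: cube n}| = (2 ^ n)%N by rewrite card_ffun card_bool card_ord.
have L1 : 1 <= L%:R :> R by rewrite ler1n.
have dX a b : exists2 h, gdist (@cube_adj n) a b = Some h & (h <= n)%N.
  apply: reach_gdist (cube_reach a b) _; rewrite cT.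
  exact: leq_ltn_trans (leq_pmull n L0) Ln.
have dX0 a b h : b != a -> gdist (@cube_adj n) a b = Some h -> (0 < h)%N.
  move=> ba /gdist_reach[+ _]; case: h => //; rewrite inE => E.
  by rewrite E in ba.
have dY a b h : gdist (@cube_adj n) a b = Some h -> (h <= n)%N ->
    exists k, [/\ gdist (perc_adj w) (f a) (f b) = Some k, (k <= L * h)%N & (h <= k + 4)%N].
  move=> ab hn; have [abr abmin] := gdist_reach ab.
  have [|k kE kh] := reach_gdist (reach_lipschitz lip abr).
    by rewrite cT; apply: leq_ltn_trans Ln; rewrite leq_mul2l hn orbT.
  exists k; split=> //.
  have [kr _] := gdist_reach kE.
  have kr' : f b \in reach (@cube_adj n) (f a) k.
    have := @reach_lipschitz _ _ (perc_adj w) (@cube_adj n) id 1 _ _ _ _ kr.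
    by rewrite mul1n; apply=> x y /andP[xy _]; apply: reach1.
  apply: abmin; rewrite (_ : k + 4 = 2 + k + 2)%N; last by lia.
  apply: reach_trans (reach_trans (near a) kr') _.
  by apply: reach_sym (near b); exact: cube_adj_sym.
rewrite /cube_perc_distortion /metric_distortion.
pose g := [ffun x => f x].
apply: (@le_trans _ _ (distortion R (gdist (@cube_adj n)) (gdist (perc_adj w)) g)).
  exact: bigmin_le_cond.
have gE x : g x = f x by rewrite ffunE.
have Dp : (Dplus R (gdist (@cube_adj n)) (gdist (perc_adj w)) g <= L%:R%:E)%E.
  rewrite /Dplus ge_max lee_fin L1 /=; apply: bigmax_le => [|a _]; first exact: leNye.
  apply: bigmax_le => [|b ba]; first exact: leNye.
  have [h hE hn] := dX a b; have [k [kE kh _]] := dY _ _ _ hE hn.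
  rewrite !gE hE kE /= lee_fin ler_pdivrMr ?ltr0n ?(dX0 a b h) //.
  by rewrite -natrM ler_nat.
have Dm : ((5%:R^-1)%:E <= Dminus R (gdist (@cube_adj n)) (gdist (perc_adj w)) g)%E.
  apply: le_bigmin => [|a _]; first exact: leey.
  apply: le_bigmin => [|b ba]; first exact: leey.
  have [h hE hn] := dX a b; have [k [kE _ hk]] := dY _ _ _ hE hn.
  have h0 := dX0 a b h ba hE.
  rewrite !gE hE kE /= lee_fin ler_pdivlMr ?ltr0n // mulrC ler_pdivrMr ?ltr0n //.
  by rewrite -natrM ler_nat; lia.
rewrite /distortion.
have Dp1 : (1 <= Dplus R (gdist (@cube_adj n)) (gdist (perc_adj w)) g)%E.
  by rewrite /Dplus le_max lexx.
case: (Dplus _ _ _ _) Dp Dp1 => //= r; rewrite !lee_fin => rL r1.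
case: (Dminus _ _ _ _) Dm => //= s.
rewrite !lee_fin => s5.
have s0 : 0 < s by apply: lt_le_trans s5; rewrite invr_gt0 ltr0n.
rewrite ler_pdivrMr // natrM; apply: (le_trans rL).
rewrite -mulrA mulrC -mulrA ler_peMr ?ler0n //.
by move: s5; rewrite -[5%:R^-1]mul1r ler_pdivrMr ?ltr0n // mulrC.
Qed.

(** * Estimates *)

Lemma perc_prob_Pr (R : realType) n (p : R) (A : pred {set {set cube n}}) :
  0 <= p <= 1 -> perc_prob p A = Pr p (enum (cube_edges n)) A.
Proof.
move=> p01; rewrite /Pr Ex_sum ?enum_uniq // /perc_prob big_mkcondr /=.
rewrite -cardE (_ : [set x in enum (cube_edges n)] = cube_edges n); last first.
  by apply/setP => x; rewrite inE mem_enum.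
by apply: eq_bigr => w _; case: (A w); rewrite ?mulr1 ?mulr0.
Qed.

(** The added 1 makes the distortion bound strict. *)
Lemma perc_prob_distortion_ge (R : realType) n N m (p : R) :
  0 <= p <= 1 -> ((m + 4) * N.+1 <= n)%N -> (4 * (5 + 2 * m) * n < 2 ^ n)%N ->
  1 - (2 ^ n * n.+1 * (N * N) ^ N * (N * N) ^ N)%:R * fail_bound p N 5 m ^+ N <=
  perc_prob p (fun w : {set {set cube n}} =>
    (cube_perc_distortion R w < (5 * (4 * (5 + 2 * m)))%:R%:E + 1)%E) <= 1.
Proof.
move=> p01 Nn Ln; rewrite perc_prob_Pr //; apply/andP; split; last first.
  by rewrite -subr_ge0 -PrN //; exact: Pr_ge0.
have n0 : (0 < n)%N by lia.
(* Blocks are consecutive runs of N + 1 coordinates; by [Nn] the default value of [insubd] never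
   occurs in the m + 4 blocks. *)
pose c r s : 'I_n := insubd (Ordinal n0) (r * N.+1 + s)%N.
have cE r s : (r < m + 4)%N -> (s <= N)%N -> c r s = (r * N.+1 + s)%N :> nat.
  by move=> rm sN; rewrite val_insubd ifT //; nia.
have c_eq r s r' s' : (r < m + 4)%N -> (r' < m + 4)%N -> (s <= N)%N -> (s' <= N)%N ->
    (c r s == c r' s') = (r == r') && (s == s').
  move=> rm rm' sN sN'; rewrite -(inj_eq val_inj) /= !cE //.
  apply/eqP/andP => [E|[/eqP-> /eqP->]] //.
  have := congr1 (divn^~ N.+1) E; rewrite !divnMDl // !divn_small // !addn0 => rr'.
  by move: E; rewrite rr' => /addnI->.
rewrite lerBlDr -lerBlDl -PrN //.
apply: le_trans (Pr_not_well_linked c_eq p01).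
apply: le_Pr => // w; apply: contra => /well_linked_embedding[f [f2 fL]].
apply: (@le_lt_trans _ _ (5 * (4 * (5 + 2 * m)))%:R%:E); first exact: cube_distortion_le f2 fL.
by rewrite lte_fin ltrDl.
Qed.

Section FailBound.
Variables (R : realType) (p X : R) (N h : nat).
Hypotheses (p01 : 0 <= p <= 1) (X1 : 1 <= X) (NX : X *+ 2 <= N%:R * p ^+ 2).

Lemma fail_bound_exp j : fail_bound p N h j.+1 <= expR (- (N%:R * p ^+ 2 * (1 - fail_bound p N h j))).
Proof.
have [p0 p1] := andP p01.
have [q0 q1] := andP (fail_bound01 p01 N h j).
rewrite -mulrA -mulrN expRM_natl /=; apply: lerXn2r.
- rewrite nnegrE subr_ge0 mulr_ile1 ?exprn_ge0 ?exprn_ile1 ?subr_ge0 //.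
  by rewrite lerBlDr lerDl.
- by rewrite nnegrE expR_ge0.
- exact: expR_ge1Dx.
Qed.

(* Each level multiplies a small success probability by at least X. *)
Lemma fail_bound_success j : 1 / 2 <= 1 - fail_bound p N h j \/ X ^+ j * p ^+ h <= 1 - fail_bound p N h j.
Proof.
have X0 : 0 <= X by apply: le_trans X1.
have X1' := X1.
elim: j => [|j IH]; first by right; rewrite expr0 mul1r /= opprB addrC subrK.
have [q0 q1] := andP (fail_bound01 p01 N h j).
set s := 1 - fail_bound p N h j in IH *.
have s0 : 0 <= s by rewrite subr_ge0.
set y := N%:R * p ^+ 2 * s.
have y0 : 0 <= y by rewrite mulr_ge0 // mulr_ge0 // exprn_ge0 //; case/andP: p01.
have sy : X * s *+ 2 <= y by rewrite -mulrnAl; apply: ler_wpM2r.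
(* From exp(-y) <= 1 / (1 + y), the new success probability is at least y / (1 + y): at least 1/2 if
   y >= 1, and at least y / 2 >= X s otherwise. *)
have qy : fail_bound p N h j.+1 <= (1 + y)^-1.
  apply: (le_trans (fail_bound_exp j)); rewrite expRN lef_pV2 ?posrE ?expR_gt0 //.
    exact: expR_ge1Dx.
  by rewrite ltr_wpDr.
move: (fail_bound p N h j.+1) qy => q' qy; clearbody y s.
have [yle|ygt] := lerP y 1; last first.
  left; have : (1 + y)^-1 <= 2^-1 by rewrite lef_pV2 ?posrE //; lra.
  by lra.
case: IH => [s2|sX].
  left; have Xs : X * (1 / 2) <= X * s by exact: ler_wpM2l X0 _ _ s2.
  have : (1 + y)^-1 <= 2^-1 by rewrite lef_pV2 ?posrE //; lra.
  by lra.
right; have : (1 + y)^-1 <= 1 - y / 2.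
  rewrite -[X in X <= _]mul1r ler_pdivrMr; last by lra.
  by nra.
have : X ^+ j.+1 * p ^+ h <= X * s by rewrite exprS -mulrA; exact: ler_wpM2l X0 _ _ sX.
by lra.
Qed.

(** After [j] levels success has probability at least 1/2, and N p^2 >= 2 X turns this into failure
    at most exp(-X) one level later. *)
Lemma fail_bound_le j : 1 <= X ^+ j * p ^+ h -> fail_bound p N h j.+1 <= expR (- X).
Proof.
move=> Xj; apply: (le_trans (fail_bound_exp j)); rewrite ler_expR lerN2.
have s2 : 1 / 2 <= 1 - fail_bound p N h j.
  by case: (fail_bound_success j) => // /(le_trans Xj); apply: le_trans; lra.
apply: (@le_trans _ _ (X *+ 2 * (1 / 2))); first by lra.
have X1' := X1; by apply: ler_pM => //; lra.
Qed.

End FailBound.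

(** Since n < K (N + 2) <= 3 K N, one has 2^n (n + 1) <= 4^n <= 64^(K N); the choices of sources and
    targets number at most n^(4 N). The whole is at most (64^K n^4 q)^N, and the decay n^(-6) of q
    brings the base below 1/n. *)
Lemma union_bound_small (R : realType) (K N n F : nat) (q : R) :
  (0 < N <= n)%N -> (n < K * (N + 2))%N -> (64 ^ K * F <= n)%N ->
  0 <= q -> q <= F%:R / n%:R ^+ 6 ->
  (2 ^ n * n.+1 * (N * N) ^ N * (N * N) ^ N)%:R * q ^+ N <= n%:R^-1.
Proof.
move=> /andP[N0 Nn] nK KF q0 qF.
have n0 : 0 < n%:R :> R by rewrite ltr0n; lia.
have n1 : 1 <= n%:R :> R by rewrite ler1n; lia.
have cnt : (2 ^ n * n.+1 * (N * N) ^ N * (N * N) ^ N <= (64 ^ K * n ^ 4) ^ N)%N.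
  rewrite -mulnA -expnMn [in leqRHS]expnMn; apply: leq_mul; last first.
    rewrite leq_exp2r // -[(n ^ 4)%N]/(n * (n * (n * n)))%N -mulnA.
    by do !apply: leq_mul.
  apply: (@leq_trans (2 ^ n * 2 ^ n)); first by rewrite leq_mul2l ltn_expl ?orbT.
  have -> : 64%N = (2 ^ 6)%N by [].
  by rewrite -expnD -!expnM leq_exp2l //; nia.
apply: (@le_trans _ _ (((64 ^ K * n ^ 4) ^ N)%:R * q ^+ N)).
  by apply: ler_wpM2r; rewrite ?exprn_ge0 // ler_nat.
rewrite natrX -exprMn.
have base : (64 ^ K * n ^ 4)%:R * q <= n%:R^-1.
  apply: (@le_trans _ _ ((64 ^ K * n ^ 4)%:R * (F%:R / n%:R ^+ 6))); first exact: ler_wpM2l.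
  rewrite natrM [(n ^ 4)%:R]natrX mulrA -[leRHS]mul1r ler_pdivrMr ?exprn_gt0 //.
  rewrite (_ : 1 / n%:R * n%:R ^+ 6 = n%:R * n%:R ^+ 4); last by field; rewrite gt_eqF.
  rewrite mulrAC -natrM; apply: ler_wpM2r; rewrite ?exprn_ge0 ?ler_nat // ltW //.
apply: (@le_trans _ _ (n%:R^-1 ^+ N)).
  by apply: lerXn2r; rewrite ?nnegrE ?mulr_ge0 ?invr_ge0 ?ler0n.
by rewrite -[leRHS]expr1; apply: ler_wiXn2l; rewrite ?invr_ge0 ?ler0n // invf_le1.
Qed.

Lemma expR_neg_le (R : realType) (X : R) k : 0 < X -> expR (- X) <= k.+1`!%:R / X ^+ k.+1.
Proof.
move=> X0; rewrite expRN -[_ / _]invrK lef_pV2 ?posrE ?expR_gt0 ?invr_gt0 ?divr_gt0 ?exprn_gt0 ?ltr0n ?fact_gt0 //.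
rewrite invf_div; apply: le_trans (expR_ge1Dxn k (ltW X0)).
by rewrite lerDr.
Qed.

Lemma ltn_sqr_expn2 n : (4 < n)%N -> (n * n < 2 ^ n)%N.
Proof.
elim: n => // n IH; rewrite ltnS leq_eqVlt => /orP[/eqP<- //|n4].
by have := IH n4; rewrite expnS; nia.
Qed.

Lemma exists_nat_mul_ge (R : realType) (a d : R) : 0 < d -> exists j : nat, a <= d * j%:R.
Proof.
move=> d0; exists (Num.bound `|a / d|).
rewrite -ler_pdivrMl // mulrC; apply: ltW.
exact: le_lt_trans (ler_norm _) (archi_boundP (normr_ge0 _)).
Qed.

(** N is one less than the quotient because each of the K blocks has N + 1 coordinates. *)
Lemma blocks_count_bounds K n : (0 < K)%N -> (3 * K <= n)%N ->
  let N := (n %/ K).-1 in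
  [/\ (0 < N <= n)%N, (1 < N)%N, (K * N.+1 <= n)%N, (n < K * (N + 2))%N & (n <= 3 * K * N)%N].
Proof.
move=> K0 nK N.
have nK3 : (3 <= n %/ K)%N by rewrite leq_divRL.
have NE : N.+1 = (n %/ K)%N by rewrite /N prednK //; apply: leq_trans nK3.
have N1 : (1 < N)%N by rewrite -ltnS NE.
have nN : (n < K * (N + 2))%N by rewrite addn2 NE mulnC ltn_ceil.
split=> //.
- by rewrite (ltnW N1) ltnW // NE leq_div.
- by rewrite NE mulnC leq_trunc_div.
- apply: (leq_trans (ltnW nN)); rewrite [(3 * K)%N]mulnC -mulnA leq_mul2l.
  by apply/orP; right; clear -N1; lia.
Qed.

(** * Choice of the constants and passage to the limit *)

Unset Implicit Arguments.
Local Open Scope classical_set_scope.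
Local Open Scope ring_scope.

Theorem theorem1 (R : realType) (alpha : R) :
  0 < alpha -> alpha < 1 / 2 ->
  exists c : R,
    (fun n : nat =>
       perc_prob (n := n) (powR n%:R (- alpha))
         (fun w => (cube_perc_distortion R (n := n) w < c%:E)%E))
      @ \oo --> (1 : R).
Proof.
move=> a0 a2; pose d : R := 1 / 2 - alpha.
have d0 : 0 < d by rewrite /d; lra.
(* With X = n^d, this makes X^j p^5 >= 1, where 5 bounds the length of a route. *)
have [j jd] := exists_nat_mul_ge (alpha * 5) d0.
(* This makes X^(l+1) >= n^6, so that exp(-X) is at most (l+1)! / n^6. *)
have [l ld] := exists_nat_mul_ge 6 d0.
pose m := j.+1; pose K := (m + 4)%N; pose L := (4 * (5 + 2 * m))%N.
exists ((5 * L)%:R + 1).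
apply/cvgrPdist_le => e e0; near=> n.
have nK : (3 * K <= n)%N by near: n; exact: nbhs_infty_ge.
have nL : (L <= n)%N by near: n; exact: nbhs_infty_ge.
have n5 : (4 < n)%N by near: n; exact: nbhs_infty_ge.
have nF : (64 ^ K * l.+1`! <= n)%N by near: n; exact: nbhs_infty_ge.
have ne : e^-1 <= n%:R by near: n; exact: nbhs_infty_ger.
have nX : (6 * K%:R) `^ d^-1 <= n%:R :> R by near: n; exact: nbhs_infty_ger.
have n0 : 0 < n%:R :> R by rewrite ltr0n (leq_trans _ n5).
have n1 : 1 <= n%:R :> R by rewrite ler1n (leq_trans _ n5).
have K0 : (0 < K)%N by rewrite /K addn4.
pose p : R := n%:R `^ (- alpha); pose X : R := n%:R `^ d.
pose N := (n %/ K).-1.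
have [Nn N2 NK NK2 nN] := blocks_count_bounds K0 nK; rewrite -/N in Nn N2 NK NK2 nN.
have p01 : 0 <= p <= 1.
  by rewrite powR_ge0 -(powRr0 n%:R) ler_powR // oppr_le0 ltW.
have X6 : 6 * K%:R <= X.
  have -> : 6 * K%:R = ((6 * K%:R) `^ d^-1) `^ d :> R.
    by rewrite -powRrM mulVf ?gt_eqF // powRr1 // mulr_ge0.
  by apply: ge0_ler_powR nX; rewrite ?nnegrE ?powR_ge0 ?ltW.
have K1 : 1 <= K%:R :> R by rewrite ler1n.
have X1 : 1 <= X by lra.
have p2X : n%:R * p ^+ 2 = X ^+ 2.
  rewrite /p /X -!powR_mulrn ?powR_ge0 // -!powRrM -[X in X * _](powRr1 (ltW n0)).
  rewrite -powRD; last by rewrite (gt_eqF n0) implybT.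
  by congr (_ `^ _); rewrite /d; lra.
(* As n p^2 = X^2 and n <= 3 K N, the right side is at least X^2 / (3 K), and X >= 6 K. *)
have NX : X *+ 2 <= N%:R * p ^+ 2.
  have : X ^+ 2 <= 3 * K%:R * N%:R * p ^+ 2.
    by rewrite -p2X -!natrM; apply: ler_wpM2r; rewrite ?ler_nat ?exprn_ge0 ?powR_ge0.
  have : 6 * K%:R * X <= X ^+ 2 by rewrite expr2 ler_wpM2r //; lra.
  move=> h1 h2; have := le_trans h1 h2.
  rewrite -!mulrA [3 * _]mulrCA [6 * _]mulrCA ler_pM2l; last by lra.
  by lra.
have Xj : 1 <= X ^+ j * p ^+ 5.
  rewrite /p /X -!powR_mulrn ?powR_ge0 // -!powRrM -powRD; last by rewrite (gt_eqF n0) implybT.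
  by rewrite -[leLHS](powRr0 n%:R) ler_powR //; lra.
have q0 : 0 <= fail_bound p N 5 m by case/andP: (fail_bound01 p01 N 5 m).
have qF : fail_bound p N 5 m <= (l.+1`!)%:R / n%:R ^+ 6.
  apply: (le_trans (fail_bound_le p01 X1 NX Xj)).
  apply: (le_trans (expR_neg_le l _)); first by lra.
  apply: ler_wpM2l => //; rewrite lef_pV2 ?posrE ?exprn_gt0 //; last by lra.
  rewrite /X -!powR_mulrn ?powR_ge0 // -powRrM ler_powR //.
  by apply: (le_trans ld); rewrite ler_pM2l // ler_nat.
have bad := union_bound_small Nn NK2 nF q0 qF.
have LN : (L * n < 2 ^ n)%N.
  by apply: leq_ltn_trans (ltn_sqr_expn2 n5); rewrite leq_mul2r nL orbT.
have /andP[lo hi] := perc_prob_distortion_ge p01 NK LN.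
rewrite EFinD -/p.
rewrite ger0_norm ?subr_ge0 //.
apply: (@le_trans _ _ n%:R^-1); last by rewrite -[e]invrK lef_pV2 ?posrE ?invr_gt0.
by rewrite lerBlDr addrC -lerBlDr; apply: le_trans lo; rewrite lerB.
Unshelve. all: by end_near.
Qed.
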